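(* For every natural number $n\geq 1$, $$p_n\geq \frac{n}{840}\left(240n^{6}+28n^{5}+364n^{4}+210n^{2}-28n+26-105((-1)^{n}+1)\right).$$
   Context: For a real square matrix $B$, $s(B)$ denotes the sum of all entries of $B$. For a natural number $n\geq 1$, $p_n$ denotes the maximum of $s(A^2)$ over all $n\times n$ matrices $A$ whose entries are the numbers $1,2,\ldots,n^2$, each appearing exactly once. Here $A^2$ is the usual matrix product $A\cdot A$. *)

(* Defs.v *)
From mathcomp Require Import all_boot all_order all_algebra.

Set Implicit Arguments.
Unset Strict Implicit.
Unset Printing Implicit Defensive.

Import Order.TTheory GRing.Theory Num.Theory.
Local Open Scope ring_scope.

Definition entry_sum (R : nmodType) (n : nat) (B : 'M[R]_n) : R :=
  \sum_(i < n) \sum_(j < n) B i j.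

Definition entries_1_to_sqr (R : realFieldType) (n : nat) (A : 'M[R]_n) : bool :=
  perm_eq [seq A i j | i <- enum 'I_n, j <- enum 'I_n]
          [seq k%:R | k <- iota 1 (n ^ 2)].

Definition natmx (R : realFieldType) (m n : nat) (A : 'M['I_m]_n) : 'M[R]_n :=
  map_mx (fun k : 'I_m => (k : nat)%:R) A.

(* The admissible matrices all have entries in {0, ..., n^2}, so they are
   enumerated through the finite type 'M['I_(n ^ 2).+1]_n. The default value 0
   plays no role, the set of admissible matrices being nonempty and all the
   values nonnegative: see max_entry_sum_sqrP. *)
Definition max_entry_sum_sqr (R : realFieldType) (n : nat) : R :=
  \big[Num.max/0]_(A : 'M['I_(n ^ 2).+1]_n | entries_1_to_sqr (natmx R A))
     entry_sum (natmx R A *m natmx R A).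

Lemma entries_natmx (R : realFieldType) (n : nat) (A : 'M[R]_n) :
  entries_1_to_sqr A ->
  exists B : 'M['I_(n ^ 2).+1]_n, A = natmx R B.
Proof.
move=> /perm_mem hA.
have h i j : exists k : 'I_(n ^ 2).+1, A i j == (k : nat)%:R.
  have : A i j \in [seq A i j | i <- enum 'I_n, j <- enum 'I_n].
    by apply/allpairsP; exists (i, j); rewrite !mem_enum.
  rewrite hA => /mapP[k]; rewrite mem_iota => /andP[_ kn] ->.
  by rewrite add1n in kn; exists (Ordinal kn).
exists (\matrix_(i, j) xchoose (h i j)); apply/matrixP => i j.
by rewrite !mxE; apply/eqP/(xchooseP (h i j)).
Qed.

Lemma entries_1_to_sqr_ex (R : realFieldType) (n : nat) :
  exists A : 'M[R]_n, entries_1_to_sqr A.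
Proof.
exists (\matrix_(i < n, j < n) (i * n + j).+1%:R).
rewrite /entries_1_to_sqr.
have -> : [seq (\matrix_(i < n, j < n) (i * n + j).+1%:R : 'M[R]_n) i j
            | i <- enum 'I_n, j <- enum 'I_n]
        = [seq k%:R | k <- [seq (i * n + j).+1 | i : 'I_n <- enum 'I_n,
                             j : 'I_n <- enum 'I_n]].
  rewrite map_allpairs; apply: eq_allpairs => // i j; by rewrite mxE.
apply: perm_map; apply: uniq_perm; last first.
- move=> k; rewrite mem_iota; apply/allpairsP/idP.
    case=> -[i j] /= [_ _ ->].
    apply/andP; split=> //; rewrite add1n ltnS -mulnn.
    apply: (@leq_trans (i * n + n)); first by rewrite ltn_add2l.
    by rewrite addnC -mulSn leq_mul2r ltn_ord orbT.
  case: k => [|k] //=; rewrite add1n ltnS -mulnn => hk.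
  have n0 : (0 < n)%N by case: (n) hk.
  have hi : (k %/ n < n)%N by rewrite ltn_divLR.
  have hj : (k %% n < n)%N by rewrite ltn_mod.
  exists (Ordinal hi, Ordinal hj); rewrite !mem_enum /=; split=> //.
  by rewrite -divn_eq.
- exact: iota_uniq.
apply: allpairs_uniq; rewrite ?enum_uniq // => -[i j] [i' j'] _ _ /= [] e.
have n0 : (0 < n)%N by exact: leq_ltn_trans (ltn_ord i).
congr pair; apply: val_inj => /=.
  by have := congr1 (divn^~ n) e; rewrite !divnMDl // !divn_small // !addn0.
by have := congr1 (modn^~ n) e; rewrite !modnMDl !modn_small.
Qed.

Lemma max_entry_sum_sqrP (R : realFieldType) (n : nat) :
  (exists2 A : 'M[R]_n, entries_1_to_sqr A &
     max_entry_sum_sqr R n = entry_sum (A *m A)) /\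
  (forall A : 'M[R]_n, entries_1_to_sqr A ->
     entry_sum (A *m A) <= max_entry_sum_sqr R n).
Proof.
have ub (A : 'M[R]_n) : entries_1_to_sqr A ->
    entry_sum (A *m A) <= max_entry_sum_sqr R n.
  move=> hA; have [B eA] := entries_natmx hA; rewrite eA in hA *.
  exact: (le_bigmax_cond 0 (fun B => entry_sum (natmx R B *m natmx R B))).
split=> //; have [A0 hA0] := entries_1_to_sqr_ex R n.
have ge0 (B : 'M['I_(n ^ 2).+1]_n) : 0 <= entry_sum (natmx R B *m natmx R B).
  apply: sumr_ge0 => i _; apply: sumr_ge0 => j _; rewrite mxE.
  by apply: sumr_ge0 => k _; rewrite !mxE mulr_ge0 ?ler0n.
have [B0 eA0] := entries_natmx hA0; rewrite eA0 in hA0.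
have [B hB eB] := Order.TotalTheory.eq_bigmax B0
  (fun B => entries_1_to_sqr (natmx R B))
  (fun B => entry_sum (natmx R B *m natmx R B)) hA0 (fun B _ => ge0 B).
by exists (natmx R B).
Qed.

(* Main.v *)
Require Import Defs.
From mathcomp Require Import all_boot all_order all_algebra.
From mathcomp Require Import ring zify.

(** The sum of the entries of $A^2$ is $\sum_k r_k c_k$, where $r_k$ and $c_k$
    are the sums of the $k$-th row and of the $k$-th column of $A$.  Writing
    $4 r_k c_k = (r_k + c_k)^2 - (r_k - c_k)^2$ shows what a good matrix looks
    like: the sums $r_k + c_k$ should be as unequal as possible, since their
    total is fixed, while each $r_k$ should be as close to $c_k$ as possible.

    The matrix [hook_entry] takes care of both.  With rows and columns counted
    from 0, the hook made of the cells $(i, j)$ with $\max(i, j) = m$ receives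
    the numbers $m^2 + 1, \dots, (m + 1)^2$, so that large numbers are
    concentrated in the last rows and columns.  Inside this hook the two
    mirror cells $(m, l)$ and $(l, m)$ share the consecutive numbers
    $m^2 + 2 l + 1$ and $m^2 + 2 l + 2$, again larger for later rows and columns,
    and the corner receives $(m + 1)^2$.
    Which mirror cell gets the larger number is immaterial for $r_k + c_k$,
    a cubic polynomial in $k$ ([row_add_col_sum]).  It is decided by the parity
    of $i + j$, so that the unit contributions to $r_k - c_k$ alternate in sign
    on each side of the diagonal; they cancel completely when $n$ is odd, and
    up to a single unit when $n$ is even ([row_sub_col_sum]).  This single unit
    is the source of the term in $(-1)^n$.  The bound is the exact value that
    this matrix gives, obtained by summing the squares of a cubic polynomial
    ([sum_cubic_sqr]). *)

Import Order.TTheory GRing.Theory Num.Theory.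
Local Open Scope ring_scope.

Lemma entry_sum_mulmx (R : pzSemiRingType) (n : nat) (A B : 'M[R]_n) :
  entry_sum (A *m B) = \sum_(k < n) (\sum_(i < n) A i k) * (\sum_(j < n) B k j).
Proof.
under [RHS]eq_bigr => k _ do rewrite big_distrlr.
rewrite exchange_big; apply: eq_bigr => i _.
rewrite exchange_big; apply: eq_bigr => j _.
by rewrite mxE.
Qed.

(** Expanding the square reduces this to Faulhaber's formulas for the exponents
    6 down to 0, whose right-hand sides are the last factors of the successive
    terms below. *)
Lemma sum_cubic_sqr (R : numFieldType) (a b c d : R) (n : nat) :
  let x := n%:R in
  \sum_(k < n) (a * k%:R ^+ 3 + b * k%:R ^+ 2 + c * k%:R + d) ^+ 2 =
    a ^+ 2 * ((6 * x ^+ 7 - 21 * x ^+ 6 + 21 * x ^+ 5 - 7 * x ^+ 3 + x) / 42)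
  + 2 * a * b * ((2 * x ^+ 6 - 6 * x ^+ 5 + 5 * x ^+ 4 - x ^+ 2) / 12)
  + (b ^+ 2 + 2 * a * c)
      * ((6 * x ^+ 5 - 15 * x ^+ 4 + 10 * x ^+ 3 - x) / 30)
  + 2 * (a * d + b * c) * ((x ^+ 4 - 2 * x ^+ 3 + x ^+ 2) / 4)
  + (c ^+ 2 + 2 * b * d) * ((2 * x ^+ 3 - 3 * x ^+ 2 + x) / 6)
  + 2 * c * d * ((x ^+ 2 - x) / 2)
  + d ^+ 2 * x.
Proof.
elim: n => [|n IHn] /=; first by rewrite big_ord0; field.
by rewrite big_ord_recr /= IHn -natr1; field.
Qed.

Lemma sum_ord_split_at (V : nmodType) (F : nat -> V) (n i : nat) :
  (i < n)%N ->
  \sum_(j < n) F j =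
    \sum_(0 <= j < i) F j + F i + \sum_(i.+1 <= j < n) F j.
Proof.
move=> lt_in; rewrite -(big_mkord xpredT).
rewrite (big_cat_nat _ (n := i)) ?(ltnW lt_in) //=.
by rewrite (big_ltn lt_in) addrA.
Qed.

Definition hook_entry (i j : nat) : nat :=
  (maxn i j ^ 2 + (minn i j).*2 + ((i < j)%N (+) odd (i + j)).+1)%N.

(** The entry determines $m = \max(i, j)$, being in $(m^2, (m + 1)^2]$, then the
    minimum and the final bit by Euclidean division by 2; off the diagonal the
    bit differs between mirror cells, so it tells $(i, j)$ from $(j, i)$. *)
Lemma hook_entry_inj (i j i' j' : nat) :
  hook_entry i j = hook_entry i' j' -> i = i' /\ j = j'.
Proof.
rewrite /hook_entry => e.
have bit_diag k l : maxn k l = minn k l -> (k < l)%N (+) odd (k + l) = false.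
  move=> kl; have -> : k = l by lia.
  by rewrite ltnn oddD addbb.
have eb := bit_diag i j; have eb' := bit_diag i' j'.
have emax : maxn i j = maxn i' j'.
  move: e eb eb'; case: (_ (+) _) => /=; case: (_ (+) _) => /= e eb eb'; nia.
rewrite emax in e.
have emin : minn i j = minn i' j'.
  move: e; case: (_ (+) _) => /=; case: (_ (+) _) => /= e; nia.
have eS : (i + j = i' + j')%N by lia.
move: e; rewrite emin eS => e.
have {e} : (i < j)%N = (i' < j')%N.
  by move: e; case: (odd _); case: (i < j)%N; case: (i' < j')%N => //=; lia.
lia.
Qed.

Lemma hook_entry_gt0 (i j : nat) : (0 < hook_entry i j)%N.
Proof. by rewrite /hook_entry addnS. Qed.

Lemma hook_entry_le (n i j : nat) :
  (i < n)%N -> (j < n)%N -> (hook_entry i j <= n ^ 2)%N.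
Proof.
move=> lt_in lt_jn; rewrite /hook_entry.
have [->|] := eqVneq i j.
  rewrite ltnn oddD addbb maxnn minnn; nia.
by case: (_ (+) _) => /=; nia.
Qed.

Lemma hook_entry_diag (i : nat) : hook_entry i i = (i.+1 ^ 2)%N.
Proof. rewrite /hook_entry ltnn oddD addbb maxnn minnn; lia. Qed.

Lemma odd_natr (R : numFieldType) (k : nat) :
  (odd k)%:R = (1 - (-1) ^+ k) / 2 :> R.
Proof. by rewrite -signr_odd; case: odd; rewrite /= ?expr0 ?expr1; field. Qed.

Lemma hook_entry_below (R : numFieldType) (i j : nat) : (j < i)%N ->
  (hook_entry i j)%:R =
    i%:R ^+ 2 + 2 * j%:R + 3 / 2 - (-1) ^+ i * (-1) ^+ j / 2 :> R.
Proof.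
move=> lt_ji; rewrite /hook_entry (maxn_idPl (ltnW lt_ji)).
rewrite (minn_idPr (ltnW lt_ji)) ltnNge (ltnW lt_ji) addFb.
by rewrite !natrD -[(nat_of_bool _).+1]addn1 natrD odd_natr
  natrX -mul2n natrM exprD; field.
Qed.

Lemma hook_entry_above (R : numFieldType) (i j : nat) : (i < j)%N ->
  (hook_entry i j)%:R =
    j%:R ^+ 2 + 2 * i%:R + 3 / 2 + (-1) ^+ i * (-1) ^+ j / 2 :> R.
Proof.
move=> lt_ij; rewrite /hook_entry (maxn_idPr (ltnW lt_ij)).
rewrite (minn_idPl (ltnW lt_ij)) lt_ij addTb !natrD.
rewrite -[(nat_of_bool _).+1]addn1 natrD.
have -> : (~~ odd (i + j))%:R = 1 - (odd (i + j))%:R :> R.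
  by case: odd; rewrite /= ?subrr ?subr0.
by rewrite odd_natr natrX -mul2n natrM exprD; field.
Qed.

Definition hook_mx (R : pzSemiRingType) (n : nat) : 'M[R]_n :=
  \matrix_(i < n, j < n) (hook_entry i j)%:R.

Lemma entries_hook_mx (R : realFieldType) (n : nat) :
  entries_1_to_sqr (hook_mx R n).
Proof.
rewrite /entries_1_to_sqr.
have -> : [seq hook_mx R n i j | i <- enum 'I_n, j <- enum 'I_n]
        = [seq k%:R | k <- [seq hook_entry i j | i : 'I_n <- enum 'I_n,
                             j : 'I_n <- enum 'I_n]].
  by rewrite map_allpairs; apply: eq_allpairs => // i j; rewrite mxE.
apply: perm_map.
have uniq_entries : uniq [seq hook_entry i j | i : 'I_n <- enum 'I_n,
                                               j : 'I_n <- enum 'I_n].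
  apply: allpairs_uniq; rewrite ?enum_uniq // => -[i j] [i' j'] _ _ /=.
  by case/hook_entry_inj => ei ej; congr pair; apply: val_inj.
(* Surjectivity comes for free by counting: there are n ^ 2 cells. *)
apply: uniq_perm; rewrite ?iota_uniq //.
apply: (uniq_min_size uniq_entries _ _).2.
  move=> k /allpairsP[[i j] /= [_ _ ->]].
  by rewrite mem_iota hook_entry_gt0 add1n ltnS hook_entry_le.
by rewrite size_iota size_allpairs size_enum_ord -mulnn.
Qed.

Lemma row_add_col_sum (R : numFieldType) (n i : nat) : (i < n)%N ->
  \sum_(j < n) ((hook_entry i j)%:R + (hook_entry j i)%:R) =
    4 / 3 * i%:R ^+ 3 + (- 1) * i%:R ^+ 2 + (4 * n%:R - 7 / 3) * i%:R
    + (2 * n%:R ^+ 3 - 3 * n%:R ^+ 2 + 10 * n%:R - 3) / 3 :> R.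
Proof.
move=> lt_in.
rewrite (sum_ord_split_at _
  (fun j => (hook_entry i j)%:R + (hook_entry j i)%:R) _ _ lt_in).
(* On either side of the diagonal the summand is a polynomial in j, and
   the functions below are discrete antiderivatives of it. *)
rewrite !hook_entry_diag (telescope_sumr_eq
  (fun j => 2 * i%:R ^+ 2 * j%:R + 2 * j%:R ^+ 2 + j%:R)) //; last first.
  move=> j /andP[_ lt_ji].
  by rewrite hook_entry_below // hook_entry_above // -[j.+1%:R]natr1; field.
rewrite (telescope_sumr_eq
  (fun j => (2 * j%:R ^+ 3 - 3 * j%:R ^+ 2 + j%:R) / 3
                 + (4 * i%:R + 3) * j%:R)) //; last first.
  move=> j /andP[lt_ij _].
  by rewrite hook_entry_above // hook_entry_below // -[j.+1%:R]natr1; field.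
by rewrite natrX -[i.+1%:R]natr1; field.
Qed.

Lemma row_sub_col_sum (R : numFieldType) (n i : nat) : (i < n)%N ->
  \sum_(j < n) ((hook_entry i j)%:R - (hook_entry j i)%:R) =
    - ((-1) ^+ i * (1 + (-1) ^+ n) / 2) :> R.
Proof.
move=> lt_in.
rewrite (sum_ord_split_at _
  (fun j => (hook_entry i j)%:R - (hook_entry j i)%:R) _ _ lt_in).
rewrite (telescope_sumr_eq (fun j => (-1) ^+ i * (-1) ^+ j / 2)) //; last first.
  move=> j /andP[_ lt_ji].
  by rewrite hook_entry_below // hook_entry_above // (exprS _ j); field.
rewrite (telescope_sumr_eq
  (fun j => - ((-1) ^+ i * (-1) ^+ j / 2))) //; last first.
  move=> j /andP[lt_ij _].
  by rewrite hook_entry_above // hook_entry_below // (exprS _ j); field.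
by rewrite (exprS _ i); field.
Qed.

Lemma entry_sum_hook_mx_sqr (R : numFieldType) (n : nat) :
  entry_sum (hook_mx R n *m hook_mx R n) =
    n%:R / 840 *
    (240 * n%:R ^+ 6 + 28 * n%:R ^+ 5 + 364 * n%:R ^+ 4 + 210 * n%:R ^+ 2
     - 28 * n%:R + 26 - 105 * ((-1) ^+ n + 1)).
Proof.
rewrite entry_sum_mulmx.
pose s (k : nat) : R :=
  4 / 3 * k%:R ^+ 3 + (- 1) * k%:R ^+ 2 + (4 * n%:R - 7 / 3) * k%:R
  + (2 * n%:R ^+ 3 - 3 * n%:R ^+ 2 + 10 * n%:R - 3) / 3.
transitivity (\sum_(k < n) (s k ^+ 2 / 4 - (1 + (-1) ^+ n) / 8)).
  apply: eq_bigr => k _; have lt_kn := ltn_ord k.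
  under eq_bigr do rewrite mxE; under [X in _ * X]eq_bigr do rewrite mxE.
  have := row_add_col_sum R _ _ lt_kn; have := row_sub_col_sum R _ _ lt_kn.
  rewrite sumrB big_split /= -/(s k).
  set r := \sum_(j < n) (hook_entry k j)%:R.
  set c := \sum_(i < n) (hook_entry i k)%:R => er_c erDc.
  have -> : c * r = (r + c) ^+ 2 / 4 - (r - c) ^+ 2 / 4 by field.
  rewrite er_c erDc sqrrN !exprMn sqrr_sign.
  (* The square of 1 + (-1) ^+ n is its double, by cases on the parity of n. *)
  by rewrite -(signr_odd _ n); case: odd; rewrite /= ?expr0 ?expr1; field.
rewrite sumrB -mulr_suml sum_cubic_sqr sumr_const card_ord -mulr_natr.
by field.
Qed.

Theorem corollary9 (R : realFieldType) (n : nat) (hn : (1 <= n)%N) :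
  max_entry_sum_sqr R n >=
    n%:R / 840 *
    (240 * n%:R ^+ 6 + 28 * n%:R ^+ 5 + 364 * n%:R ^+ 4 + 210 * n%:R ^+ 2
     - 28 * n%:R + 26 - 105 * ((-1) ^+ n + 1)).
Proof.
rewrite -entry_sum_hook_mx_sqr.
exact: (max_entry_sum_sqrP R n).2 _ (entries_hook_mx R n).
Qed.
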